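(* Let $G$ be a graph on the vertex set $\{1,\ldots,n\}$, and let $\mathbf{A}$, $\mathbf{B}$ and the maps $\phi:\mathbf{A}\to\mathbf{B}$ and $\psi:\mathbf{B}\to\mathbf{A}$ be as defined in the context. Then $\phi$ and $\psi$ define a bijective correspondence between the sets $\mathbf{A}$ and $\mathbf{B}$; that is, $\phi$ and $\psi$ are mutually inverse bijections.
   Context: Graphs are finite and simple, $n\ge 1$. For a graph $H$ on $\{1,\ldots,n\}$, $\overline{H}$ is its complement (same vertices; an edge belongs to $\overline{H}$ iff it does not belong to $H$), and the extended graph $\widetilde{H}$ is the graph on $\{0,1,\ldots,n\}$ obtained from $H$ by adding the edge $\{0,v\}$ for every $v\in\{1,\ldots,n\}$. $K_n$ is the complete graph on $\{1,\ldots,n\}$. Rooted trees. Every spanning tree $T$ of an extended graph is rooted at $0$ and regarded as a directed graph, each edge being directed toward $0$; so every vertex $u\neq 0$ has exactly one outgoing edge $(u,v)\in E(T)$. A vertex $u$ is called a child of a vertex $u_1$ in $T$ if there is a directed path in $T$ from $u$ to $u_1$ (so ''child'' means descendant, not only immediate child). Deleting the vertex $0$ from $T$ gives a spanning rooted forest $T^\circ$ on $\{1,\ldots,n\}$, whose roots are the vertices $u$ with $(u,0)\in E(T)$. When a directed pair $(u,v)$ is said to be (or not to be) in $E(\overline{G})$, this refers to the undirected edge $\{u,v\}$. Operational sets. Let $T$ be a spanning tree of $\widetilde{K_n}$. A valid pair of $T$ is a directed edge $(u,v)$ of $T^\circ$ (i.e. an edge $(u,v)\in E(T)$ with $v\ne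 0$). Let $Z_{G,T}$ be the set of valid pairs $(u,v)$ of $T$ with $(u,v)\notin E(\overline{G})$. An operational set for $T$ (with respect to $G$) is any set of the form $\mathcal{O}=C\cup Z_{G,T}$, where $C$ is a subset of the set of valid pairs of $T$ not in $Z_{G,T}$. Weight sequences. Let $F$ be a spanning tree of $\widetilde{\overline{G}}$ whose forest $F^\circ$ has $k$ connected components. A weight sequence of $F$ is any sequence $(w_1,\ldots,w_{k-1})$ with each $w_j\in\{0,1,\ldots,n\}$ (the empty sequence if $k=1$). The sets. $\mathbf{A}$ is the set of all pairs $(T,\mathcal{O})$ with $T$ a spanning tree of $\widetilde{K_n}$ and $\mathcal{O}$ an operational set for $T$ with respect to $G$. $\mathbf{B}$ is the set of all pairs $(F,W)$ with $F$ a spanning tree of $\widetilde{\overline{G}}$ and $W$ a weight sequence of $F$. The map $\phi:\mathbf{A}\to\mathbf{B}$. Input: $(T,\mathcal{O})\in\mathbf{A}$. Let $S$ be the set of vertices $u\neq 0$ whose outgoing edge $(u,v)\in E(T)$ satisfies $(u,v)\in\mathcal{O}$ or $v=0$. Let $W$ be an empty sequence and $F$ a copy of $T$. While $|S|>1$, do: (1) If there is a leaf $u'\neq 0$ of (the current) $T$ with $u'\notin S$, remove $u'$ and its outgoing edge $(u',v')$ from $T$. (2) Repeat step (1) until every leaf $u\neq 0$ of $T$ is in $S$. Let $M$ be the set of all these leaves. (3) Let $u^*$ be the largest vertex in $M$ and $(u^*,v^* )$ its outgoing edge in $T$. Delete $u^*$ and $(u^*,v^* )$ from $T$, replace $S$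 by $S\setminus\{u^*\}$, and append $v^*$ to the end of $W$. (4) In $F$, remove the edge $(u^*,v^* )$ and add the edge $(u^*,0)$. When the loop ends, return $\phi(T,\mathcal{O})=(F,W)$ (with $T$ on the left denoting the original input tree). The map $\psi:\mathbf{B}\to\mathbf{A}$. Input: $(F,W)\in\mathbf{B}$. Let $F^*$ be a copy of $F$, $W^*$ a copy of the sequence $W$, $\mathcal{O}$ the empty set, and $R$ the set of roots of $F^\circ$. While the length of $W^*$ is larger than $0$, do: (1) Let $w$ be the first element of the sequence $W^*$. Let $u$ be the largest vertex in $R$ such that no entry $w_i$ of (the current) $W^*$, including $w$, is equal to $u$ or is a child of $u$ in $F^*$. Delete the first element $w$ from the sequence $W^*$ and delete $u$ from $R$. (2) In $F^*$, remove the edge $(u,0)$ and add the edge $(u,w)$. If $w\neq 0$, add the pair $(u,w)$ to $\mathcal{O}$. When the loop ends, return $\psi(F,W)=(F^*,\mathcal{O})$. *)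

(* Defs.v *)
From mathcomp Require Import all_boot.

Set Implicit Arguments.
Unset Strict Implicit.
Unset Printing Implicit Defensive.

(* The vertex set {0, ..., n} is 'I_n.+1, with 0 = ord0. A graph on {1, ..., n}
   is a relation on 'I_n.+1 with no edge at ord0, so labels are not shifted. *)
Section Graphs.
Variable n : nat.
Implicit Types G H : rel 'I_n.+1.

Definition simple_graph H : Prop :=
  [/\ symmetric H, irreflexive H
    & forall x y, H x y -> (x != ord0) && (y != ord0)].

Definition compl H : rel 'I_n.+1 :=
  [rel x y | [&& x != ord0, y != ord0, x != y & ~~ H x y]].

Definition complete : rel 'I_n.+1 :=
  [rel x y | [&& x != ord0, y != ord0 & x != y]].

Definition extended H : rel 'I_n.+1 :=
  [rel x y | H x y || ((x == ord0) (+) (y == ord0))].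

End Graphs.

(* Rooted trees and the digraphs met by the two algorithms are sets of arcs. *)
Notation arcs n := {set 'I_n.+1 * 'I_n.+1}.

Section Trees.
Variable n : nat.
Implicit Types (T : arcs n) (H : rel 'I_n.+1) (u v : 'I_n.+1).

Definition arc T : rel 'I_n.+1 := [rel u v | (u, v) \in T].

Definition edge T : rel 'I_n.+1 := [rel u v | arc T u v || arc T v u].

Definition connected T : Prop := forall u v, connect (edge T) u v.

(* ucycle also accepts the closed walks u, v, u along a single edge, hence the
   bound 2 rather than 0. *)
Definition acyclic T : Prop := forall c, ucycle (edge T) c -> size c <= 2.

(* Every edge carries exactly one direction, and the directions lead to 0. *)
Definition directed_to0 T : Prop :=
  (forall u v, arc T u v -> ~~ arc T v u) /\
  (forall u, connect (arc T) u ord0).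

Definition spanning_tree H T : Prop :=
  [/\ forall u v, edge T u v -> H u v, connected T, acyclic T
    & directed_to0 T].

(* u is a descendant of v. *)
Definition child T u v : bool :=
  [exists x, arc T u x && connect (arc T) x v].

(* Deleted vertices stay in the ambient type 'I_n.+1 but have degree 0, so they
   are not leaves. *)
Definition leaf T u : bool := #|[set v | edge T u v]| == 1.

Definition forest T : arcs n :=
  [set a in T | (a.1 != ord0) && (a.2 != ord0)].

Definition roots T : {set 'I_n.+1} := [set u | arc T u ord0].

Definition components T : nat :=
  n_comp (edge (forest T)) [pred u | u != ord0].

Definition largest (M : {set 'I_n.+1}) u : Prop :=
  u \in M /\ forall x, x \in M -> x <= u.

End Trees.

Section Correspondence.
Variables (n : nat) (G : rel 'I_n.+1).
Implicit Types (T F O : arcs n) (S R : {set 'I_n.+1}) (W : seq 'I_n.+1).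

Definition valid_pairs T : arcs n := forest T.

Definition Zset T : arcs n :=
  [set a in valid_pairs T | ~~ compl G a.1 a.2].

Definition operational T O : Prop :=
  exists2 C : arcs n, C \subset valid_pairs T :\: Zset T & O = C :|: Zset T.

Definition weight_sequence F W : Prop := size W = components F - 1.

Definition inA (a : arcs n * arcs n) : Prop :=
  spanning_tree (extended (@complete n)) a.1 /\ operational a.1 a.2.

Definition inB (b : arcs n * seq 'I_n.+1) : Prop :=
  spanning_tree (extended (compl G)) b.1 /\ weight_sequence b.1 b.2.

End Correspondence.

(* The algorithms are given by their input-output relations, because the order
   in which phi prunes leaves is not prescribed. *)
Section Algorithms.
Variable n : nat.
Implicit Types (T F O : arcs n) (S R : {set 'I_n.+1}) (W : seq 'I_n.+1).

Definition phi_S T O : {set 'I_n.+1} :=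
  [set u | (u != ord0) &&
    [exists v, arc T u v && (((u, v) \in O) || (v == ord0))]].

Inductive prune S : arcs n -> arcs n -> Prop :=
| prune_stop T of (forall u, u != ord0 -> leaf T u -> u \in S) : prune S T T
| prune_leaf T T' u v of
    u != ord0 & leaf T u & u \notin S & arc T u v &
    prune S (T :\ (u, v)) T' : prune S T T'.

Definition nonroot_leaves T : {set 'I_n.+1} :=
  [set u | (u != ord0) && leaf T u].

(* phi_loop T S F W b: the while loop, entered in state (T, S, F, W), can end
   with output b; similarly for psi_loop. *)
Inductive phi_loop :
    arcs n -> {set 'I_n.+1} -> arcs n -> seq 'I_n.+1 ->
    arcs n * seq 'I_n.+1 -> Prop :=
| phi_exit T S F W of #|S| <= 1 : phi_loop T S F W (F, W)
| phi_iter T S F W T' u v b of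
    1 < #|S| & prune S T T' & largest (nonroot_leaves T') u & arc T' u v &
    phi_loop (T' :\ (u, v)) (S :\ u) ((u, ord0) |: (F :\ (u, v)))
      (rcons W v) b :
    phi_loop T S F W b.

Definition phi (a : arcs n * arcs n) (b : arcs n * seq 'I_n.+1) : Prop :=
  phi_loop a.1 (phi_S a.1 a.2) a.1 [::] b.

Definition psi_candidates F R W : {set 'I_n.+1} :=
  [set u in R | all (fun w => ~~ ((w == u) || child F w u)) W].

Inductive psi_loop :
    arcs n -> arcs n -> {set 'I_n.+1} -> seq 'I_n.+1 ->
    arcs n * arcs n -> Prop :=
| psi_exit F O R : psi_loop F O R [::] (F, O)
| psi_iter F O R w W u a of
    largest (psi_candidates F R (w :: W)) u &
    psi_loop ((u, w) |: (F :\ (u, ord0)))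
      (if w != ord0 then (u, w) |: O else O) (R :\ u) W a :
    psi_loop F O R (w :: W) a.

Definition psi (b : arcs n * seq 'I_n.+1) (a : arcs n * arcs n) : Prop :=
  psi_loop b.1 set0 (roots b.1) b.2 a.

End Algorithms.

(* Main.v *)
Require Import Defs.
From mathcomp Require Import all_boot.

Set Implicit Arguments.
Unset Strict Implicit.
Unset Printing Implicit Defensive.

(** A rooted tree is its parent function [p], normalised by [p 0 = 0]; deleting arcs
    then means restricting [p] to fewer vertices, and replacing arcs by arcs to [0] is
    [cut p D].

    Fix [p] and the set [S] of vertices that [phi] still has to treat. However its
    leaves are pruned, what is left is the set of ancestors of [S]
    ([prune_outarcs]), and the leaves left are the minimal elements of [S]: those
    with no other element of [S] below them ([leaves_pruned]). So [phi] is
    deterministic. It lists [S] in the order [peel] that always takes the largest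
    minimal element, records the parents of the vertices taken, and outputs the cut
    of the tree along [S] ([phi_loopP]). The last vertex, whose parent is not
    recorded, is a root ([peel_rest]).

    The map [psi] does not know [p]; it only sees [cut p S] and the parents still to
    be restored. The point of the theorem is that this is enough to find the same
    minimal elements ([candidates_minimal]): an element of [S] is minimal exactly
    when no remaining weight is equal to it or below it in [cut p S]. Hence [psi]
    undoes [phi] one step at a time ([psi_run_peel]). Conversely, [psi] is never
    stuck, because each remaining weight rules out at most one of the roots not yet
    treated, and these are more numerous ([candidate_exists]); reading its run
    backwards, the pair it starts from is what [phi] records for the tree it ends
    with ([psi_unpeel]).

    Finally, an operational set is determined by the set [S] that [phi] computes from
    it, and determines it ([operational_marks]): it consists of the arcs out of [S]
    that do not end at [0]. The arcs outside [S] are those that must lie in the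
    complement of [G], which matches the condition on the trees of [B]. *)

Local Notation arc := Defs.arc.
Local Notation roots := Defs.roots.

(** * Rooted parent functions *)

Section RootedFunctions.
Variable n : nat.
Local Notation V := 'I_n.+1.
Implicit Types (p q : {ffun V -> V}) (u v w x y : V) (S D X : {set V}).

Definition rooted p : Prop := p ord0 = ord0 /\ forall u, fconnect p u ord0.

Lemma fconnect_ind p v (P : V -> Prop) :
    P v -> (forall x, fconnect p (p x) v -> P (p x) -> P x) ->
  forall x, fconnect p x v -> P x.
Proof.
move=> Pv PS x /iter_findex; move: (findex p x v) => k.
elim: k x => [|k IHk] x; first by move=> /= ->.
rewrite iterSr => pk; apply: PS; last exact: IHk.
by rewrite -pk fconnect_iter.
Qed.

Lemma fconnect_comparable p x u v :
  fconnect p x u -> fconnect p x v -> fconnect p u v || fconnect p v u.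
Proof.
move=> xu xv; move: xv; move: x xu; apply: fconnect_ind => [->//|x pxu IH].
rewrite fconnect_eqVf => /predU1P[<-|/IH//].
by rewrite [fconnect p x u]fconnect_eqVf pxu !orbT.
Qed.

Lemma rooted_fconnect0 p v : rooted p -> fconnect p ord0 v = (v == ord0).
Proof.
move=> [p0 _]; apply/idP/eqP => [|->]; last exact: connect0.
by move/iter_findex <-; elim: (findex _ _ _) => //= k ->.
Qed.

(** If [x] lay on a directed cycle, so would its parent, and so on up to [0]. *)
Lemma rooted_irr p u : rooted p -> u != ord0 -> fconnect p (p u) u = false.
Proof.
move=> p_rooted; have [p0 p_to0] := p_rooted.
move: u (p_to0 u); apply: fconnect_ind => [|x _ IHx] x_neq0.
  by rewrite eqxx in x_neq0.
apply/negP => xx; have [px0|px_neq0] := eqVneq (p x) ord0.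
  by rewrite px0 rooted_fconnect0 // (negPf x_neq0) in xx.
move: (IHx px_neq0); rewrite fconnect_eqVf in xx.
have [pxx|/connect_trans->//] := predU1P xx; last exact: fconnect1.
by rewrite !pxx connect0.
Qed.

(** Depth in a rooted tree: a vertex has one ancestor more than its parent. *)
Lemma rooted_order_lt p u :
  rooted p -> u != ord0 -> order p (p u) < order p u.
Proof.
move=> p_rooted u_neq0; apply/proper_card/properP; split.
  by apply/subsetP=> x; apply: connect_trans; apply: fconnect1.
by exists u; rewrite -topredE /= ?connect0 ?rooted_irr.
Qed.

Lemma rooted_fixed p u v :
  rooted p -> p u = ord0 -> v != ord0 -> fconnect p u v -> u = v.
Proof.
move=> p_rooted pu v_neq0; rewrite fconnect_eqVf pu rooted_fconnect0 //.
by rewrite (negPf v_neq0) orbF => /eqP.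
Qed.

Lemma rooted_root p u : rooted p -> u != ord0 ->
  exists r, [/\ r != ord0, p r = ord0 & fconnect p u r].
Proof.
move=> p_rooted; have [p0 p_to0] := p_rooted; move: u (p_to0 u).
apply: fconnect_ind => [|x _ IHx x_neq0]; first by rewrite eqxx.
have [px0|/IHx[r [r0 pr xr]]] := eqVneq (p x) ord0.
  by exists x; rewrite connect0.
by exists r; split=> //; rewrite fconnect_eqVf xr orbT.
Qed.

Lemma rooted_root_uniq p u r s :
    rooted p -> r != ord0 -> s != ord0 -> p r = ord0 -> p s = ord0 ->
  fconnect p u r -> fconnect p u s -> r = s.
Proof.
move=> p_rooted r0 s0 pr ps ur us.
case/orP: (fconnect_comparable ur us) => [/(rooted_fixed p_rooted pr s0) //|].
by move/(rooted_fixed p_rooted ps r0).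
Qed.

Definition cut p D : {ffun V -> V} := [ffun x => if x \in D then ord0 else p x].

Lemma cut_rooted p D : rooted p -> rooted (cut p D).
Proof.
move=> [p0 p_to0]; split=> [|u]; first by rewrite ffunE p0 if_same.
move: u (p_to0 u); apply: fconnect_ind => [|x _ IHx]; first exact: connect0.
rewrite fconnect_eqVf ffunE; case: ifP => _; first by rewrite connect0 orbT.
by rewrite IHx orbT.
Qed.

Lemma cut_fconnect p D u v :
  rooted p -> v != ord0 -> fconnect (cut p D) u v -> fconnect p u v.
Proof.
move=> p_rooted v_neq0; move: u; apply: fconnect_ind => [|x]; first exact: connect0.
rewrite ffunE; case: ifP => [_|_ _ xv]; last by rewrite fconnect_eqVf xv orbT.
by rewrite rooted_fconnect0 ?(negPf v_neq0) //; apply: cut_rooted.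
Qed.

(** If some arc on the path from [y] up to [u] leaves an element of [S], the last such
    arc is the one out of [x], and what follows it survives in [cut p S]. *)
Lemma cut_last_exit p S y u : fconnect p y u ->
  fconnect (cut p S) y u \/
  exists x, x \in S /\ fconnect (cut p S) (p x) u.
Proof.
move: y; apply: fconnect_ind => [|y _ [IHy|]]; [by left; apply: connect0| |by right].
have [->|y_neq_u] := eqVneq y u; first by left; apply: connect0.
have [yS|yNS] := boolP (y \in S); [by right; exists y|left].
by rewrite fconnect_eqVf ffunE (negPf yNS) IHy orbT.
Qed.

Definition redirect p u w : {ffun V -> V} := [ffun x => if x == u then w else p x].

(** A path that avoids [u] is unchanged, and [w] starts one, so the detour from [u]
    through [w] still leads to [0]. *)
Lemma redirect_rooted p u w :
  rooted p -> u != ord0 -> ~~ fconnect p w u -> rooted (redirect p u w).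
Proof.
move=> [p0 p_to0] u_neq0 wu; split=> [|y]; first by rewrite ffunE eq_sym (negPf u_neq0).
have avoid z : ~~ fconnect p z u -> fconnect (redirect p u w) z ord0.
  move: z (p_to0 z); apply: fconnect_ind => [|z _ IHz]; first by rewrite connect0.
  rewrite fconnect_eqVf negb_or => /andP[z_neq_u zu].
  by rewrite fconnect_eqVf ffunE (negPf z_neq_u) IHz ?orbT.
move: y (p_to0 y); apply: fconnect_ind => [|y _ IHy]; first exact: connect0.
by rewrite fconnect_eqVf ffunE; case: ifP => _; rewrite ?IHy ?avoid ?orbT.
Qed.

End RootedFunctions.

(** * Trees as parent functions *)

Section ParentFunctions.
Variable n : nat.
Local Notation V := 'I_n.+1.
Implicit Types (p q : {ffun V -> V}) (u v w x y : V) (X D : {set V}) (T : arcs n).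
Implicit Types H : rel V.

Definition outarcs p X : arcs n := [set a | (a.1 \in X) && (a.2 == p a.1)].

Definition tree p : arcs n := outarcs p [set~ ord0].

Definition parent T : {ffun V -> V} := [ffun u => odflt ord0 [pick v | arc T u v]].

Lemma arc_outarcs p X u v : arc (outarcs p X) u v = (u \in X) && (v == p u).
Proof. by rewrite /arc /= inE. Qed.

Lemma arc_tree p u v : arc (tree p) u v = (u != ord0) && (v == p u).
Proof. by rewrite arc_outarcs !inE. Qed.

Lemma tree_parent p : p ord0 = ord0 -> parent (tree p) = p.
Proof.
move=> p0; apply/ffunP=> u; rewrite ffunE; case: pickP => [v|no_arc] /=.
  by rewrite arc_tree => /andP[_ /eqP].
have [->//|u_neq0] := eqVneq u ord0.
by have := no_arc (p u); rewrite arc_tree u_neq0 eqxx.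
Qed.

Lemma connect_tree p : rooted p -> connect (arc (tree p)) =2 fconnect p.
Proof.
move=> [p0 _] u v; apply/idP/idP.
  apply: connect_sub => x y; rewrite arc_tree => /andP[_ /eqP->].
  exact: fconnect1.
move: u; apply: fconnect_ind => [|x _ IHx]; first exact: connect0.
have [x0|x_neq0] := eqVneq x ord0; first by rewrite x0 p0 in IHx; rewrite x0.
by apply: connect_trans IHx; apply: connect1; rewrite arc_tree x_neq0 /=.
Qed.

(** On a cycle, a vertex of greatest depth has its parent as only neighbour,
    so both its neighbours along the cycle coincide. *)
Lemma tree_acyclic p : rooted p -> acyclic (tree p).
Proof.
move=> p_rooted c /andP[]; case: c => [//|x0 c0] cyc uniq_c.
set c := x0 :: c0 in cyc uniq_c *.
have [x xc x_max] := @arg_maxnP _ x0 [in c] (order p) (mem_head _ _).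
have nbr y : y \in c -> edge (tree p) x y -> y = p x.
  move=> yc; rewrite /edge /= !arc_tree => /orP[/andP[_ /eqP//]|].
  move=> /andP[y_neq0 /eqP xpy]; have /= := x_max y yc.
  by rewrite xpy leqNgt rooted_order_lt.
have [i s def_c] := rot_to xc.
rewrite -(size_rot i) def_c; move: cyc uniq_c; rewrite -(rot_cycle i) -(rot_uniq i) def_c.
have {}nbr y : y \in s -> edge (tree p) x y -> y = p x.
  by move=> ys; apply: nbr; rewrite -(mem_rot i) def_c inE ys orbT.
case: s nbr {def_c} => [|y [|z s]] //= nbr /and3P[xy _].
rewrite rcons_path => /andP[_ lx] /and3P[_ y_notin _].
have yE : y = p x by apply: nbr; rewrite ?mem_head.
have lE : last z s = p x.
  by apply: nbr; [rewrite inE mem_last orbT | rewrite /edge /= orbC].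
by move: (mem_last z s); rewrite lE -yE (negPf y_notin).
Qed.

Lemma tree_spanning H p :
    symmetric H -> rooted p ->
    (forall u, u != ord0 -> p u != ord0 -> H u (p u)) ->
  spanning_tree (extended H) (tree p).
Proof.
move=> H_sym p_rooted pH.
have sub_H u v : arc (tree p) u v -> extended H u v && extended H v u.
  rewrite arc_tree => /andP[u_neq0 /eqP->]; rewrite /extended /= H_sym (negPf u_neq0).
  by case: (eqVneq (p u) ord0) => pu; rewrite ?orbT // H_sym pH.
have e_sym : connect_sym (edge (tree p)).
  by apply: sym_connect_sym => x y; rewrite /edge /= orbC.
have to0 u : connect (edge (tree p)) u ord0.
  have := p_rooted.2 u; rewrite -connect_tree //; apply: connect_sub => x y xy.
  by apply: connect1; rewrite /edge /= xy.
split=> [u v /orP[] /sub_H/andP[] //|u v||].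
- by rewrite (connect_trans (to0 u)) // e_sym.
- exact: tree_acyclic.
split=> [u v|u]; last by rewrite connect_tree //; apply: p_rooted.2.
rewrite !arc_tree => /andP[u_neq0 /eqP->]; rewrite negb_and.
apply/orP; right; apply: contraFN (rooted_irr p_rooted u_neq0) => /eqP upu.
by rewrite {2}upu fconnect1.
Qed.

(** A path from [u] to [v] that avoids the edge between them would close up to a cycle
    through that edge. *)
Lemma acyclic_bridge T (D : rel V) u v :
    acyclic T -> subrel D (edge T) -> edge T v u -> u != v -> ~~ D u v ->
  ~~ connect D u v.
Proof.
move=> T_acyc D_sub vu u_neq_v uNv; apply/negP => /connectP[s].
case/shortenP => s' path_s' uniq_s' _ v_last.
suff /T_acyc: ucycle (edge T) (u :: s').
  case: s' path_s' uniq_s' v_last => [_ _ v_last|y [|z s']] //=.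
    by rewrite v_last eqxx in u_neq_v.
  by rewrite andbT => uy _ v_last; rewrite -v_last (negPf uNv) in uy *.
by rewrite /ucycle uniq_s' andbT /= rcons_path (sub_path D_sub) // -v_last.
Qed.

(** Acyclicity makes the digraph functional. A directed cycle would be a cycle; and
    if [u] had two arcs, to [x] and to [y], then both ends of the edge [u x] would
    still be joined through [0] after its removal. *)
Lemma spanning_tree_parent H T :
    spanning_tree (extended H) T ->
    (forall x y, H x y -> (x != ord0) && (y != ord0)) ->
  exists p, [/\ T = tree p, rooted p & forall u, u != ord0 -> p u != ord0 -> H u (p u)].
Proof.
move=> [sub_H _ T_acyc [T_anti to0]] H_n0.
have T_irr u : arc T u u = false.
  by apply/negP => uu; have := T_anti _ _ uu; rewrite uu.
have arc_neq u v : arc T u v -> u != v.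
  by apply: contraTneq => ->; rewrite T_irr.
have no_dicycle u v : arc T u v -> ~~ connect (arc T) v u.
  move=> uv; apply: (acyclic_bridge T_acyc); last exact: T_anti.
  - by move=> x y xy; apply/orP; left.
  - by apply/orP; left.
  - by rewrite eq_sym arc_neq.
have no_arc0 v : ~~ arc T ord0 v.
  by apply/negP => /no_dicycle; rewrite to0.
have functional u x y : arc T u x -> arc T u y -> x = y.
  move=> ux uy; apply/eqP/negPn/negP => x_neq_y.
  pose D := [rel a b | edge T a b && ((a, b) \notin [set (u, x); (x, u)])].
  have D_sym : connect_sym D.
    apply: sym_connect_sym => a b; rewrite /D /edge /= !inE !xpair_eqE.
    rewrite [arc T b a || _]orbC.
    by rewrite [(b == u) && _ || _]orbC [(b == x) && _]andbC [(b == u) && _]andbC.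
  (* A directed path to [0] that never meets [u] avoids the edge between [u] and [x]. *)
  have below z : ~~ connect (arc T) z u -> connect D z ord0.
    have /connectP[s] := to0 z; elim: s z => [|a s IHs] z /=.
      by move=> _ ->; rewrite connect0.
    case/andP=> za path_s last_s zu.
    have au : ~~ connect (arc T) a u.
      by apply: contra zu; apply: connect_trans; apply: connect1.
    apply: connect_trans (IHs _ path_s last_s au); apply: connect1.
    rewrite /D /edge /= za /= !inE !xpair_eqE negb_or !negb_and.
    have z_neq_u : z != u by apply: contraNneq zu => ->; apply: connect0.
    have a_neq_u : a != u by apply: contraNneq au => ->; apply: connect0.
    by rewrite z_neq_u a_neq_u orbT.
  have /negP[] : ~~ connect D u x.
    apply: (acyclic_bridge T_acyc); rewrite ?arc_neq //.
    - by move=> a b /andP[].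
    - by apply/orP; right.
    - by rewrite /D /= !inE eqxx andbF.
  apply: (@connect_trans _ _ y).
    apply: connect1; rewrite /D /edge /= uy /= !inE !xpair_eqE eqxx /=.
    by rewrite eq_sym (negPf x_neq_y) (negPf (arc_neq _ _ ux)).
  by apply: (@connect_trans _ _ ord0); last rewrite D_sym; apply/below/no_dicycle.
have parentE u v : arc T u v -> parent T u = v.
  move=> uv; rewrite ffunE; case: pickP => [x ux|/(_ v)]; last by rewrite uv.
  exact: functional ux uv.
have arc_parent u : u != ord0 -> arc T u (parent T u).
  move=> u_neq0; have /connectP[[|v s] /=] := to0 u.
    by move=> _ u0; rewrite u0 eqxx in u_neq0.
  by case/andP=> uv _ _; rewrite (parentE _ _ uv).
have T_tree : T = tree (parent T).
  apply/setP=> -[u v]; rewrite -[LHS]/(arc T u v) -[RHS]/(arc _ u v) arc_tree.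
  apply/idP/andP => [uv|[/arc_parent u_arc /eqP->//]].
  by rewrite (parentE _ _ uv) eqxx; split=> //; apply: contraTneq uv => ->.
exists (parent T); split=> // [|u u_neq0 pu].
  split=> [|u].
    by rewrite ffunE; case: pickP => // v; rewrite (negPf (no_arc0 v)).
  have /connectP[s] := to0 u; elim: s u => [|a s IHs] u /=.
    by move=> _ ->; apply: connect0.
  by case/andP=> /parentE ua /IHs ih /ih a_to0; rewrite fconnect_eqVf ua a_to0 orbT.
have /sub_H/orP[//|] : edge T u (parent T u) by apply/orP; left; apply: arc_parent.
by rewrite (negPf u_neq0) (negPf pu).
Qed.

Lemma forest_tree p : rooted p ->
  forest (tree p) = outarcs p [set u | (u != ord0) && (p u != ord0)].
Proof.
move=> p_rooted; apply/setP=> -[u v]; rewrite !inE /=.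
by case: (v =P p u) => [->|_]; rewrite ?andbF ?andbT //=; case: (u != ord0).
Qed.

Lemma roots_tree p : roots (tree p) = [set u | (u != ord0) && (p u == ord0)].
Proof. by apply/setP=> u; rewrite inE arc_tree inE [ord0 == _]eq_sym. Qed.

(** The component of [r] in the forest is the set of vertices below [r], so each
    component contains exactly one root. *)
Lemma components_tree p : rooted p -> components (tree p) = #|roots (tree p)|.
Proof.
move=> p_rooted; pose e := edge (forest (tree p)).
have e_sym : connect_sym e.
  by apply: sym_connect_sym => x y; rewrite /e /edge /= orbC.
have eE x y : arc (forest (tree p)) x y = [&& x != ord0, p x != ord0 & y == p x].
  by rewrite forest_tree // arc_outarcs inE andbA.
have below r : r != ord0 -> p r = ord0 -> closed e [pred x | fconnect p x r].
  move=> r_neq0 pr; apply: intro_closed => // x y /=.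
  rewrite /e /edge /= !eE !inE => /orP[] /and3P[_ px /eqP yE].
    rewrite fconnect_eqVf => /predU1P[xr|]; last by rewrite yE.
    by rewrite xr pr eqxx in px.
  by rewrite yE => xr; rewrite fconnect_eqVf xr orbT.
have to_root x r : r != ord0 -> p r = ord0 -> fconnect p x r -> connect e x r.
  move=> r_neq0 pr; move: x; apply: fconnect_ind => [|x xr IHx]; first exact: connect0.
  apply: connect_trans IHx; apply: connect1; rewrite /e /edge /= eE eqxx andbT.
  apply/orP; left; apply/andP; split; apply: contraTneq xr => x0.
    by rewrite x0 p_rooted.1 rooted_fconnect0.
  by rewrite x0 rooted_fconnect0.
have e_n0 : closed e [pred u | u != ord0].
  apply: intro_closed => // x y /=.
  by rewrite /e /edge /= !eE !inE => /orP[] /and3P[? ? /eqP->].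
rewrite /components -/e /n_comp_mem.
rewrite -(card_in_imset (f := root e) (D := roots (tree p))).
  apply: eq_card => x; rewrite !inE; apply/andP/imsetP.
    move=> [/eqP x_root x_neq0].
    have [r [r_neq0 pr xr]] := rooted_root p_rooted x_neq0.
    exists r; first by rewrite roots_tree inE r_neq0 pr eqxx.
    by rewrite -{1}x_root; apply/rootP/to_root.
  move=> [r]; rewrite roots_tree inE => /andP[r_neq0 _] ->.
  split; first exact: (roots_root e_sym).
  by have /= := closed_connect e_n0 (connect_root e r); rewrite !inE => <-.
move=> r s; rewrite !roots_tree !inE => /andP[r0 /eqP pr] /andP[s0 /eqP ps].
move=> /(rootP e_sym) rs.
have /= := closed_connect (below r r0 pr) rs; rewrite !inE connect0 => /esym sr.
by rewrite (rooted_fixed p_rooted ps r0 sr).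
Qed.

End ParentFunctions.

(** * Pruning *)

Section Pruning.
Variable n : nat.
Local Notation V := 'I_n.+1.
Implicit Types (p q : {ffun V -> V}) (u v w x y r : V) (S X : {set V}) (T : arcs n).

Definition upclosed p X : Prop :=
  ord0 \notin X /\ forall x, x \in X -> p x != ord0 -> p x \in X.

Definition ancestors p S : {set V} :=
  [set x | (x != ord0) && [exists s in S, fconnect p s x]].

Definition minimal p S : {set V} :=
  [set u in S | [forall s in S, fconnect p s u ==> (s == u)]].

Lemma minimalP p S u :
  reflect (u \in S /\ forall s, s \in S -> fconnect p s u -> s = u) (u \in minimal p S).
Proof.
rewrite inE; apply: (iffP andP) => -[uS u_min]; split=> //.
  by move=> s sS su; apply/eqP; have /forall_inP/(_ s sS)/implyP/(_ su) := u_min.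
by apply/forall_inP => s sS; apply/implyP => /(u_min s sS) ->.
Qed.

Lemma minimal_exists p S s : rooted p -> ord0 \notin S -> s \in S ->
  exists u, u \in minimal p S.
Proof.
move=> p_rooted S_n0 sS; have [u /= uS u_max] := @arg_maxnP _ s [in S] (order p) sS.
exists u; apply/minimalP; split=> // x xS.
rewrite fconnect_eqVf => /predU1P[//|pxu].
have x_neq0 : x != ord0 by apply: contraNneq S_n0 => <-.
have := u_max x xS; rewrite leqNgt; case/negP.
apply: leq_ltn_trans (rooted_order_lt p_rooted x_neq0).
by apply/subset_leq_card/subsetP => y; apply: connect_trans.
Qed.

Lemma fconnect_last p x u :
  fconnect p x u -> x != u -> exists2 y, p y = u & fconnect p x y.
Proof.
move: x; apply: fconnect_ind => [|x _ IHx x_neq_u]; first by rewrite eqxx.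
have [pxu|/IHx[y yu xy]] := eqVneq (p x) u; first by exists x; rewrite ?connect0.
by exists y; rewrite // fconnect_eqVf xy orbT.
Qed.

Lemma ancestors_upclosed p S : upclosed p (ancestors p S).
Proof.
split=> [|x]; first by rewrite inE eqxx.
rewrite !inE => /andP[_ /exists_inP[s sS sx]] ->; apply/exists_inP; exists s => //.
exact: connect_trans sx (fconnect1 _ _).
Qed.

Lemma sub_ancestors p S : ord0 \notin S -> S \subset ancestors p S.
Proof.
move=> S_n0; apply/subsetP => s sS; rewrite inE; apply/andP; split.
  by apply: contraNneq S_n0 => <-.
by apply/exists_inP; exists s; rewrite ?connect0.
Qed.

Lemma upclosed_fconnect p X x y : rooted p -> upclosed p X ->
  fconnect p x y -> y != ord0 -> x \in X -> y \in X.
Proof.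
move=> p_rooted [_ X_up] xy y_neq0; move: x xy.
apply: fconnect_ind => [//|x pxy IHx xX]; apply/IHx/X_up => //.
by apply: contraTneq pxy => ->; rewrite rooted_fconnect0.
Qed.

Lemma leaf_outarcs p X u : rooted p -> upclosed p X -> u != ord0 ->
  leaf (outarcs p X) u = (u \in X) && [forall x in X, p x != u].
Proof.
move=> p_rooted [_ X_up] u_neq0; rewrite /leaf.
have edgeE v :
  edge (outarcs p X) u v = (u \in X) && (v == p u) || (v \in X) && (u == p v).
  by rewrite /edge /= !arc_outarcs.
have [uX|uNX] /= := boolP (u \in X); last first.
  rewrite (_ : [set _ | _] = set0) ?cards0 //; apply/setP => v.
  rewrite !inE edgeE (negPf uNX) /=; apply/andP => -[vX /eqP upv].
  by rewrite upv X_up // -upv in uNX.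
apply/idP/forall_inP => [/cards1P[z nbrs] x xX|no_child].
  have zE v : edge (outarcs p X) u v -> v = z.
    by move=> uv; apply/set1P; rewrite -nbrs inE.
  apply/negP => /eqP pxu.
  have xE : x = p u.
    rewrite [p u]zE; first by apply: zE; rewrite edgeE xX pxu eqxx orbT.
    by rewrite edgeE uX eqxx.
  by have := rooted_irr p_rooted u_neq0; rewrite -xE -pxu fconnect1.
rewrite (_ : [set _ | _] = [set p u]) ?cards1 //; apply/setP => v.
rewrite !inE edgeE uX /=; case: eqP => //= _; apply/negP => /andP[vX /eqP upv].
by have := no_child v vX; rewrite -upv eqxx.
Qed.

(** A deepest vertex of [X] below [x] has no child in [X]. *)
Lemma eq_ancestors p S X : rooted p -> upclosed p X -> S \subset X ->
    (forall u, u \in X -> (forall x, x \in X -> p x != u) -> u \in S) ->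
  X = ancestors p S.
Proof.
move=> p_rooted X_up /subsetP S_sub leaf_S; apply/setP/subset_eqP/andP; split.
  apply/subsetP => x xX; rewrite inE; apply/andP; split.
    by apply: contraNneq X_up.1 => <-.
  pose P := [pred y | (y \in X) && fconnect p y x].
  have Px : P x by rewrite /P /= xX connect0.
  have [y /andP[yX yx] y_max] := @arg_maxnP _ x P (order p) Px.
  apply/exists_inP; exists y => //; apply: leaf_S => // z zX.
  apply/negP => /eqP pzy; have z_neq0 : z != ord0.
    by apply: contraNneq X_up.1 => <-.
  have /= := y_max z; rewrite zX fconnect_eqVf pzy yx orbT => /(_ isT).
  by rewrite -pzy leqNgt rooted_order_lt.
apply/subsetP => x; rewrite inE => /andP[x_neq0 /exists_inP[s /S_sub sX sx]].
exact: (upclosed_fconnect p_rooted X_up sx).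
Qed.

Lemma outarcs_rem p X u : outarcs p X :\ (u, p u) = outarcs p (X :\ u).
Proof.
apply/setP => -[x y]; rewrite !inE xpair_eqE /=.
by have [->|//] := eqVneq x u; case: (y == p u); rewrite /= ?andbF.
Qed.

Lemma upclosed_rem p X u : upclosed p X -> (forall x, x \in X -> p x != u) ->
  upclosed p (X :\ u).
Proof.
move=> [X_n0 X_up] no_child; split=> [|x]; rewrite !inE.
  by rewrite (negPf X_n0) andbF.
by move=> /andP[_ xX] px; rewrite no_child ?X_up.
Qed.

(** Pruning keeps the upward closed set [X] above [S]; it stops when all leaves are in
    [S], which forces [X] to be the set of ancestors of [S], in whatever order the
    leaves were removed. *)
Lemma prune_outarcs p S X T : rooted p -> upclosed p X -> S \subset X ->
  (prune S (outarcs p X) T <-> T = outarcs p (ancestors p S)).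
Proof.
move=> p_rooted X_up S_sub; split.
  move T0E: (outarcs p X) => T0 pr.
  elim: pr X X_up S_sub T0E => {T0 T} 
    [T0 leaf_S|T0 T u v u_neq0 u_leaf uNS uv _ IH] X X_up S_sub T0E.
    rewrite -(eq_ancestors p_rooted X_up S_sub) // => u uX no_child.
    have u_neq0 : u != ord0 by apply: contraNneq X_up.1 => <-.
    apply: leaf_S; rewrite // -T0E leaf_outarcs // uX; exact/forall_inP.
  move: u_leaf uv IH; rewrite -T0E leaf_outarcs // arc_outarcs.
  move=> /andP[uX /forall_inP no_child] /andP[_ /eqP->]; rewrite outarcs_rem => IH.
  apply: (IH (X :\ u)) => //; first exact: upclosed_rem.
  apply/subsetP => s sS; rewrite !inE (subsetP S_sub) // andbT.
  by apply: contraNneq uNS => <-.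
move=> ->; have [m] := ubnP #|X|; elim: m X X_up S_sub => // m IHm X X_up S_sub leX.
have [/existsP[u /and3P[u_neq0 u_leaf uNS]]|no_leaf] :=
  boolP [exists u, [&& u != ord0, leaf (outarcs p X) u & u \notin S]].
  move: (u_leaf); rewrite leaf_outarcs // => /andP[uX /forall_inP no_child].
  apply: (@prune_leaf _ _ _ _ u (p u)) => //; first by rewrite arc_outarcs uX /=.
  rewrite outarcs_rem; apply: IHm; first exact: upclosed_rem.
    apply/subsetP => s sS; rewrite !inE (subsetP S_sub) // andbT.
    by apply: contraNneq uNS => <-.
  by move: leX; rewrite (cardsD1 u X) uX.
have leaf_S u : u != ord0 -> leaf (outarcs p X) u -> u \in S.
  move=> u_neq0 u_leaf; apply: contraNT no_leaf => uNS; apply/existsP; exists u.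
  by rewrite u_neq0 u_leaf.
rewrite -(eq_ancestors p_rooted X_up S_sub); first exact: prune_stop.
move=> u uX no_child; have u_neq0 : u != ord0 by apply: contraNneq X_up.1 => <-.
by apply: leaf_S; rewrite // leaf_outarcs // uX; apply/forall_inP.
Qed.

Lemma minimal_no_child p S u x :
  rooted p -> u \in minimal p S -> x \in ancestors p S -> p x != u.
Proof.
move=> p_rooted /minimalP[_ u_min]; rewrite inE => /andP[x_neq0 /exists_inP[s sS sx]].
apply/negP => /eqP pxu; have := rooted_irr p_rooted x_neq0.
rewrite pxu -[X in fconnect p X](u_min s sS) ?sx //.
by apply: connect_trans sx _; rewrite -pxu fconnect1.
Qed.

(** The leaves left by pruning are the elements of [S] with no element of [S]
    strictly below. *)
Lemma leaves_pruned p S : rooted p -> ord0 \notin S ->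
  nonroot_leaves (outarcs p (ancestors p S)) = minimal p S.
Proof.
move=> p_rooted S_n0; apply/setP => u; rewrite [LHS]inE; apply/idP/idP.
  case/andP=> u_neq0; rewrite leaf_outarcs //; last exact: ancestors_upclosed.
  rewrite {1}inE u_neq0 => /andP[/exists_inP[s sS su] /forall_inP no_child].
  have below x : x \in S -> fconnect p x u -> x = u.
    move=> xS xu; apply/eqP; apply: contraT => /(fconnect_last xu)[y pyu xy].
    suff /no_child : y \in ancestors p S by rewrite pyu eqxx.
    rewrite inE; apply/andP; split; last by apply/exists_inP; exists x.
    by apply: contra_neq u_neq0 => y0; rewrite -pyu y0 p_rooted.1.
  by apply/minimalP; split=> //; rewrite -(below s).
move=> u_min; have [uS _] := minimalP _ _ _ u_min.
have u_neq0 : u != ord0 by apply: contraNneq S_n0 => <-.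
rewrite u_neq0 leaf_outarcs //; last exact: ancestors_upclosed.
rewrite (subsetP (sub_ancestors p S_n0)) //=.
by apply/forall_inP => x; apply: minimal_no_child.
Qed.

End Pruning.

(** * The removal order and the two loops *)

Section Loops.
Variable n : nat.
Local Notation V := 'I_n.+1.
Implicit Types (p q : {ffun V -> V}) (u v w x y r : V) (S D R X M : {set V}).
Implicit Types (T F O : arcs n) (W us : seq V).

(** The default [0] is only met for the empty set. *)
Definition top M : V := odflt ord0 [pick u in M | [forall x in M, x <= u]].

Lemma largest_top M u : largest M u -> u = top M.
Proof.
move=> [uM u_max]; rewrite /top; case: pickP => [x /andP[xM /forall_inP x_max]|/(_ u)].
  by apply/ord_inj/anti_leq; rewrite u_max // x_max.
by rewrite /= uM => /forall_inP; case.
Qed.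

Lemma top_largest M x : x \in M -> largest M (top M).
Proof.
move=> xM; have [u /= uM u_max] := @arg_maxnP _ x [in M] val xM.
suff u_top : largest M u by rewrite -(largest_top u_top).
by split.
Qed.

(** The first [k] vertices of [S] in the order in which both algorithms treat them. *)
Fixpoint peel p k S : seq V :=
  if k is k'.+1 then let u := top (minimal p S) in u :: peel p k' (S :\ u)
  else [::].

Lemma size_peel p k S : size (peel p k S) = k.
Proof. by elim: k S => //= k IHk S; rewrite IHk. Qed.

(** What both loops preserve of their active set [S], and what makes the last vertex
    left in it a root. *)
Definition root_closed p S : Prop := ord0 \notin S /\
  forall u r, u \in S -> r != ord0 -> p r = ord0 -> fconnect p u r -> r \in S.

Lemma root_closed_neq0 p S u : root_closed p S -> u \in S -> u != ord0.
Proof. by move=> [S_n0 _] uS; apply: contraNneq S_n0 => <-. Qed.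

Lemma minimal_top p S k : rooted p -> root_closed p S -> #|S| = k.+1 ->
  largest (minimal p S) (top (minimal p S)).
Proof.
move=> p_rooted [S_n0 _] cardS; have /card_gt0P[s sS] : 0 < #|S| by rewrite cardS.
by have [u /top_largest] := minimal_exists p_rooted S_n0 sS.
Qed.

Lemma card_rem S u k : u \in S -> #|S| = k.+1 -> #|S :\ u| = k.
Proof. by move=> uS; rewrite (cardsD1 u) uS => -[]. Qed.

Lemma root_closed_rem p S u :
  root_closed p S -> u \in minimal p S -> root_closed p (S :\ u).
Proof.
move=> [S_n0 S_cl] /minimalP[uS u_min]; split=> [|x r].
  by rewrite !inE negb_and S_n0 orbT.
rewrite !inE => /andP[x_neq_u xS] r_neq0 pr xr; rewrite (S_cl x) // andbT.
by apply: contra_neq x_neq_u => ru; apply: u_min; rewrite // -ru.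
Qed.

(** Since roots are only removed after everything below them, the vertex that is
    never removed is a root. *)
Lemma peel_rest p k S : rooted p -> root_closed p S -> #|S| = k.+1 ->
  exists r, p r = ord0 /\ S =i r :: peel p k S.
Proof.
move=> p_rooted; elim: k S => [|k IHk] S S_cl cardS.
  have /eqP/cards1P[x S_x] := cardS.
  have xS : x \in S by rewrite S_x set11.
  have x_neq0 := root_closed_neq0 S_cl xS.
  have [r [r_neq0 pr xr]] := rooted_root p_rooted x_neq0.
  have := S_cl.2 x r xS r_neq0 pr xr; rewrite S_x => /set1P rx.
  by exists x; rewrite -{1}rx; split=> // y; rewrite !inE.
have [u_min _] := minimal_top p_rooted S_cl cardS.
have [uS _] := minimalP _ _ _ u_min.
have [r [pr S_r]] := IHk _ (root_closed_rem S_cl u_min) (card_rem uS cardS).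
exists r; split=> // x; have := S_r x; rewrite !inE.
by have [->|] := eqVneq x (top _); rewrite /= ?orbT ?uS.
Qed.

Lemma child_tree q w u : rooted q -> u != ord0 ->
  (w == u) || child (tree q) w u = fconnect q w u.
Proof.
move=> q_rooted u_neq0; rewrite fconnect_eqVf; congr (_ || _).
apply/existsP/idP => [[x /andP[]]|qwu].
  by rewrite arc_tree connect_tree // => /andP[_ /eqP->].
exists (q w); rewrite arc_tree connect_tree // eqxx qwu !andbT.
apply: contraTneq qwu => ->; rewrite q_rooted.1 rooted_fconnect0 //.
Qed.

Lemma psi_candidatesP q R W u : rooted q -> ord0 \notin R ->
  reflect (u \in R /\ forall w, w \in W -> ~~ fconnect q w u)
          (u \in psi_candidates (tree q) R W).
Proof.
move=> q_rooted R_n0; rewrite inE.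
apply: (iffP andP) => -[uR W_u]; split=> //.
  move=> w /(allP W_u); rewrite child_tree //.
  by apply: contraNneq R_n0 => <-.
apply/allP => w /W_u; rewrite child_tree //.
by apply: contraNneq R_n0 => <-.
Qed.

(** The heart of the correspondence: [phi] looks at the original tree [p], [psi] only
    at [cut p S] and the remaining weights, and both see the same eligible vertices.
    If [x] in [S] lies strictly below [u], take the last exit from [S] on the way
    to [u]: it is an arc cut by [phi], whose recorded endpoint is still
    joined to [u] in [cut p S]. *)
Lemma candidates_minimal p S r us :
    rooted p -> ord0 \notin S -> p r = ord0 -> S =i r :: us ->
  psi_candidates (tree (cut p S)) S (map p us) = minimal p S.
Proof.
move=> p_rooted S_n0 pr S_us; have c_rooted := cut_rooted S p_rooted.
apply/setP => u; apply/psi_candidatesP/minimalP => // -[uS Hu]; split=> //.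
  have u_neq0 : u != ord0 by apply: contraNneq S_n0 => <-.
  move=> s sS su; apply/eqP; apply: contraT => s_neq_u.
  have [x [xS pxu]] : exists x, x \in S /\ fconnect (cut p S) (p x) u.
    have [|//] := cut_last_exit S su.
    by move/(rooted_fixed c_rooted _ u_neq0) => su'; rewrite su' ?eqxx // ffunE sS
      in s_neq_u.
  move: xS; rewrite S_us inE => /predU1P[xr|x_us].
    by move: pxu; rewrite xr pr rooted_fconnect0 // (negPf u_neq0).
  by have := Hu (p x); rewrite map_f // pxu => /(_ isT).
have u_neq0 : u != ord0 by apply: contraNneq S_n0 => <-.
move=> w /mapP[x x_us ->]; apply/negP => /(cut_fconnect p_rooted u_neq0) pxu.
have xu : x = u.
  by apply: Hu; rewrite ?S_us ?inE ?x_us ?orbT // fconnect_eqVf pxu orbT.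
by have := rooted_irr p_rooted u_neq0; rewrite -{1}xu pxu.
Qed.

Lemma outarcs_redirect p X u w : u \in X ->
  (u, w) |: (outarcs p X :\ (u, p u)) = outarcs (redirect p u w) X.
Proof.
move=> uX; apply/setP => -[x y]; rewrite !inE !xpair_eqE /= ffunE.
by have [->|//] := eqVneq x u; rewrite uX /=; case: (y == p u); rewrite /= ?orbF ?andbF.
Qed.

Lemma cut_id p S : (forall x, x \in S -> p x = ord0) -> cut p S = p.
Proof. by move=> pS; apply/ffunP => x; rewrite ffunE; case: ifP => // /pS ->. Qed.

Lemma phi_loop_inv T S F W b : phi_loop T S F W b ->
  (#|S| <= 1 /\ b = (F, W)) \/
  exists T' u v, [/\ 1 < #|S|, prune S T T', largest (nonroot_leaves T') u, arc T' u v
    & phi_loop (T' :\ (u, v)) (S :\ u) ((u, ord0) |: (F :\ (u, v))) (rcons W v) b].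
Proof. by case=> [|T0 S0 F0 W0 T' u v b0 *]; [left | right; exists T', u, v]. Qed.

(** [D] collects the vertices already treated, [X] those still in the tree. At the
    exit one root is left in [S]; cutting it changes nothing, so the output is the
    cut along all of [D :|: S]. *)
Lemma phi_loopP p k S X D W b :
    rooted p -> root_closed p S -> #|S| = k.+1 -> upclosed p X -> S \subset X ->
    [disjoint D & S] ->
  phi_loop (outarcs p X) S (tree (cut p D)) W b <->
  b = (tree (cut p (D :|: S)), W ++ map p (peel p k S)).
Proof.
move=> p_rooted; elim: k S X D W => [|k IHk] S X D W S_cl cardS X_up SX DS.
  have [r [pr S_r]] := peel_rest p_rooted S_cl cardS.
  have -> : cut p (D :|: S) = cut p D.
    apply/ffunP => x; rewrite !ffunE !inE S_r inE.
    by have [->|] := eqVneq x r; rewrite ?orbF // pr !if_same.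
  rewrite cats0; split=> [/phi_loop_inv[[_ //]|[T' [u [v []]]]]|->].
    by rewrite cardS.
  by apply: phi_exit; rewrite cardS.
have [u_min u_max] := minimal_top p_rooted S_cl cardS.
set u := top _ in u_min u_max *; have [uS _] := minimalP _ _ _ u_min.
have S_n0 := S_cl.1; have u_neq0 := root_closed_neq0 S_cl uS.
have uD : u \notin D by rewrite (disjointFl DS uS).
have u_anc : u \in ancestors p S by apply: (subsetP (sub_ancestors p S_n0)).
have step : phi_loop (outarcs p (ancestors p S) :\ (u, p u)) (S :\ u)
    ((u, ord0) |: (tree (cut p D) :\ (u, p u))) (rcons W (p u)) b <->
    b = (tree (cut p (D :|: S)), W ++ map p (peel p k.+1 S)).
  have -> : (u, ord0) |: (tree (cut p D) :\ (u, p u)) = tree (cut p (u |: D)).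
    have -> : p u = cut p D u by rewrite ffunE (negPf uD).
    rewrite outarcs_redirect ?inE //; congr tree; apply/ffunP => x.
    by rewrite !ffunE !inE; case: eqVneq.
  have -> : D :|: S = (u |: D) :|: (S :\ u).
    by apply/setP => x; rewrite !inE; have [->|] := eqVneq x u; rewrite ?uS ?orbT.
  rewrite outarcs_rem /= -/u -cat_rcons; apply: IHk.
  - exact: root_closed_rem.
  - exact: card_rem.
  - apply: upclosed_rem; first exact: ancestors_upclosed.
    by move=> x; apply: minimal_no_child.
  - exact/setSD/sub_ancestors.
  rewrite disjoint_sym disjoints_subset; apply/subsetP => x.
  rewrite !inE negb_or => /andP[-> xS]; by rewrite (disjointFl DS xS).
split=> [/phi_loop_inv[[]|[T' [u' [v []]]]]|/step loop_b].
- by rewrite cardS.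
- move=> _ /(prune_outarcs _ p_rooted X_up SX)->; rewrite leaves_pruned //.
  by move/largest_top => ->; rewrite arc_outarcs => /andP[_ /eqP->] /step.
apply: phi_iter loop_b; first by rewrite cardS.
- exact/prune_outarcs.
- by rewrite leaves_pruned.
by rewrite arc_outarcs u_anc /=.
Qed.

Fixpoint psi_run F O R W : arcs n * arcs n :=
  if W is w :: W' then
    let u := top (psi_candidates F R W) in
    psi_run ((u, w) |: (F :\ (u, ord0))) (if w != ord0 then (u, w) |: O else O)
      (R :\ u) W'
  else (F, O).

Lemma psi_loop_run F O R W a : psi_loop F O R W a -> a = psi_run F O R W.
Proof. by elim=> //= {}F {}O {}R w {}W u {}a /largest_top <-. Qed.

(** The operational set that [phi] reads and [psi] builds. *)
Definition marks p S : arcs n := [set a in outarcs p S | a.2 != ord0].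

Lemma in_marks p S u v : ((u, v) \in marks p S) = [&& u \in S, v == p u & v != ord0].
Proof. by rewrite !inE -andbA. Qed.

Lemma marks_rem p S u O : u \in S ->
  (if p u != ord0 then (u, p u) |: O else O) :|: marks p (S :\ u) = O :|: marks p S.
Proof.
move=> uS; apply/setP => -[x y]; rewrite !inE /=.
case: ifP => pu; rewrite ?inE ?xpair_eqE;
  have [->|] := eqVneq x u => //=; rewrite uS /=.
  by case: (y =P p u) => [->|]; rewrite /= ?pu ?orbT ?orbF.
by case: (y =P p u) => [->|]; rewrite /= ?pu ?orbF.
Qed.

Lemma psi_step p S u : u \in S -> u != ord0 ->
  (u, p u) |: (tree (cut p S) :\ (u, ord0)) = tree (cut p (S :\ u)).
Proof.
move=> uS u_neq0; have -> : ord0 = cut p S u by rewrite ffunE uS.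
rewrite outarcs_redirect ?inE //; congr tree; apply/ffunP => x; rewrite !ffunE !inE.
by have [->|] := eqVneq x u.
Qed.

(** With [S] the active set, [psi] chooses the vertex that [peel] lists first and
    restores its arc, which turns [cut p S] into the cut along the rest of [S]. *)
Lemma psi_run_peel p k S O : rooted p -> root_closed p S -> #|S| = k.+1 ->
  psi_run (tree (cut p S)) O S (map p (peel p k S)) = (tree p, O :|: marks p S).
Proof.
move=> p_rooted; elim: k S O => [|k IHk] S O S_cl cardS.
  have [r [pr S_r]] := peel_rest p_rooted S_cl cardS.
  have pS x : x \in S -> p x = ord0 by rewrite S_r inE => /eqP->.
  rewrite /= cut_id //; congr pair; apply/setP => -[x y]; rewrite !inE /=.
  by case: (boolP (x \in S)) => [/pS ->|]; case: eqP; rewrite /= ?orbF.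
have [r [pr S_r]] := peel_rest p_rooted S_cl cardS.
have := candidates_minimal p_rooted S_cl.1 pr S_r.
have [u_min _] := minimal_top p_rooted S_cl cardS.
have [uS _] := minimalP _ _ _ u_min.
rewrite /= => ->; set u := top _ in u_min uS *.
have u_neq0 := root_closed_neq0 S_cl uS.
rewrite psi_step // IHk; last exact: card_rem.
  by rewrite marks_rem.
exact: root_closed_rem.
Qed.

Lemma redirect_fconnect q u w x y : ~~ fconnect q x u ->
  fconnect (redirect q u w) x y -> fconnect q x y.
Proof.
move=> xu xy; move: x xy xu; apply: fconnect_ind => [|x _]; first by rewrite connect0.
rewrite ffunE; have [->|x_neq_u] := eqVneq x u; first by rewrite connect0.
by rewrite !(fconnect_eqVf q x) (negPf x_neq_u) /= => IHx /IHx ->; rewrite orbT.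
Qed.

(** Every weight lies below at most one root, so the weights cannot rule out all of
    the more numerous elements of [R]. *)
Lemma candidate_exists q R W : rooted q -> ord0 \notin R ->
    (forall r, r \in R -> q r = ord0) -> size W < #|R| ->
  exists u, u \in psi_candidates (tree q) R W.
Proof.
move=> q_rooted R_n0 qR; case: (set_0Vmem (psi_candidates (tree q) R W)); last first.
  by case=> u u_cand _; exists u.
move=> no_cand; rewrite ltnNge => /negP[].
pose root_of w := odflt ord0 [pick r in R | fconnect q w r].
have R_n0' r : r \in R -> r != ord0 by move=> rR; apply: contraNneq R_n0 => <-.
suff sub : {subset R <= map root_of W}.
  rewrite -(size_map root_of W); apply: leq_trans (card_size _).
  by apply/subset_leq_card/subsetP.
move=> r rR; have [/hasP[w wW wr]|/hasPn W_r] := boolP (has (fconnect q ^~ r) W).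
  apply/mapP; exists w => //; rewrite /root_of; case: pickP => [s /andP[sR ws]|/(_ r)].
    exact: (rooted_root_uniq q_rooted (R_n0' r rR) (R_n0' s sR) (qR r rR) (qR s sR) wr ws).
  by rewrite /= rR wr.
by have : r \in psi_candidates (tree q) R W; [apply/psi_candidatesP | rewrite no_cand inE].
Qed.

(** Running [psi] from [q] with active roots [R] produces a tree [p] of which [q] is
    the cut and [W] the record. Roots above a weight are assumed to be active:
    this survives each step because the chosen root has no remaining weight below it.
    It is what makes [R] closed under taking roots in [p]. *)
Lemma psi_unpeel q R W O : rooted q -> ord0 \notin R ->
    (forall r, r \in R -> q r = ord0) -> #|R| = (size W).+1 ->
    (forall w r, w \in W -> r != ord0 -> q r = ord0 -> fconnect q w r -> r \in R) ->
  psi_loop (tree q) O R W (psi_run (tree q) O R W) /\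
  exists p, [/\ rooted p, root_closed p R, cut p R = q & W = map p (peel p (size W) R)].
Proof.
elim: W q R O => [|w W IHW] q R O q_rooted R_n0 qR cardR W_R.
  split; first exact: psi_exit.
  exists q; split=> //; last exact: cut_id.
  split=> // u r uR r_neq0 qr.
  by move/(rooted_fixed q_rooted (qR u uR) r_neq0) => <-.
have [u0 /top_largest u_top] : exists u, u \in psi_candidates (tree q) R (w :: W).
  by apply: candidate_exists; rewrite // cardR.
move: (u_top); rewrite [psi_run _ _ _ _]/=; set u := top _ => -[u_cand _].
have /psi_candidatesP[//|//|uR u_free] := u_cand.
have u_neq0 : u != ord0 by apply: contraNneq R_n0 => <-.
have wu : ~~ fconnect q w u by apply: u_free; apply: mem_head.
have redirectE : (u, w) |: (tree q :\ (u, ord0)) = tree (redirect q u w).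
  by rewrite /tree -outarcs_redirect ?inE // qR.
have [|||||loop1 [p [p_rooted p_cl p_cut WE]]] := IHW (redirect q u w) (R :\ u)
    (if w != ord0 then (u, w) |: O else O).
- exact: redirect_rooted.
- by rewrite !inE negb_and R_n0 orbT.
- by move=> r; rewrite !inE ffunE => /andP[/negPf-> /qR].
- exact: card_rem cardR.
- move=> x r xW r_neq0 qr; have xu : ~~ fconnect q x u.
    by apply: u_free; rewrite inE xW orbT.
  move/(redirect_fconnect xu) => xr; rewrite !inE.
  have r_neq_u : r != u by apply: contraNneq xu => <-.
  rewrite r_neq_u (W_R x) ?inE ?xW ?orbT //.
  by move: qr; rewrite ffunE (negPf r_neq_u).
split; first by apply: psi_iter u_top _; rewrite redirectE.
have pu : p u = w.
  by have := congr1 (fun f : {ffun _} => f u) p_cut; rewrite !ffunE !inE !eqxx.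
have p_cutR : cut p R = q.
  apply/ffunP => x; have := congr1 (fun f : {ffun _} => f x) p_cut; rewrite !ffunE !inE.
  by have [->|] := eqVneq x u; [rewrite uR qR|].
have p_clR : root_closed p R.
  split=> // x r xR r_neq0 pr xr.
  have [xu|x_neq_u] := eqVneq x u; last first.
    by apply: (subsetP (subD1set R u)); apply: (p_cl.2 x); rewrite // !inE x_neq_u.
  (* The root above [w] in [q] is active and is not [u]; it stays above [w] in [p],
     where its own root is the root of [u]. *)
  move: xr; rewrite {x xR}xu fconnect_eqVf => /predU1P[<-//|]; rewrite pu => wr.
  have w_neq0 : w != ord0 by apply: contraTneq wr => ->; rewrite rooted_fconnect0.
  have [s [s_neq0 qs ws]] := rooted_root q_rooted w_neq0.
  have sR : s \in R by apply: W_R qs ws; rewrite ?mem_head.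
  have s_neq_u : s != u by apply: contraNneq wu => <-.
  have pws : fconnect p w s by move: ws; rewrite -p_cutR; apply: cut_fconnect.
  have {}sR : s \in R :\ u by rewrite !inE s_neq_u.
  have [t [t_neq0 pt st]] := rooted_root p_rooted s_neq0.
  have tR := p_cl.2 s t sR t_neq0 pt st.
  rewrite (rooted_root_uniq p_rooted r_neq0 t_neq0 pr pt wr (connect_trans pws st)).
  by move: tR; rewrite !inE => /andP[].
exists p; split=> //=.
suff -> : top (minimal p R) = u by rewrite pu -WE.
have [r [pr R_r]] := peel_rest p_rooted p_cl (card_rem uR cardR).
rewrite /u -p_cutR; congr top; rewrite -pu WE -map_cons; apply/esym.
apply: (candidates_minimal p_rooted R_n0 pr) => x; rewrite !inE.
have := R_r x; rewrite !inE; have [->|_ /= ->] := eqVneq x u; first by rewrite uR orbT.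
by [].
Qed.

End Loops.

(** * The correspondence *)

Section Values.
Variables (n : nat) (G : rel 'I_n.+1).
Local Notation V := 'I_n.+1.
Implicit Types (p q : {ffun V -> V}) (u v w x y r : V) (R : {set V}).
Implicit Types (F T O : arcs n) (W : seq V).

Definition phi_value (a : arcs n * arcs n) : arcs n * seq V :=
  let p := parent a.1 in let S := phi_S a.1 a.2 in
  (tree (cut p S), map p (peel p #|S|.-1 S)).

Definition psi_value (b : arcs n * seq V) : arcs n * arcs n :=
  psi_run b.1 set0 (roots b.1) b.2.

Lemma in_phi_S p O u :
  (u \in phi_S (tree p) O) = (u != ord0) && (((u, p u) \in O) || (p u == ord0)).
Proof.
rewrite inE; have [//|u_neq0 /=] := eqVneq u ord0.
apply/existsP/idP => [[v]|uS].
  by rewrite arc_tree => /andP[/andP[_ /eqP->]].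
by exists (p u); rewrite arc_tree u_neq0 eqxx.
Qed.

Lemma phi_S_root_closed p O : root_closed p (phi_S (tree p) O).
Proof.
split=> [|u r _ r_neq0 pr _]; first by rewrite in_phi_S eqxx.
by rewrite in_phi_S r_neq0 pr eqxx orbT.
Qed.

Lemma card_phi_S p O : 0 < n -> rooted p ->
  #|phi_S (tree p) O| = #|phi_S (tree p) O|.-1.+1.
Proof.
move=> n_gt0 p_rooted; rewrite prednK //; apply/card_gt0P.
have [//|r [r_neq0 pr _]] := @rooted_root _ p ord_max p_rooted.
  by rewrite -val_eqE /= -lt0n.
by exists r; rewrite in_phi_S r_neq0 pr eqxx orbT.
Qed.

Lemma roots_cut_phi_S p O :
  roots (tree (cut p (phi_S (tree p) O))) = phi_S (tree p) O.
Proof.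
apply/setP => u; rewrite roots_tree [LHS]inE ffunE.
case: ifP; first by rewrite in_phi_S eqxx andbT => /andP[].
by rewrite in_phi_S; case: (u != ord0); case: (_ == _); rewrite ?orbT.
Qed.

(** A valid pair outside an operational set is an edge of the complement of [G], and
    membership of [u] in [phi_S] tells whether the arc out of [u] was chosen. *)
Lemma operational_marks p O : rooted p -> operational G (tree p) O ->
  O = marks p (phi_S (tree p) O).
Proof.
move=> p_rooted [C /subsetP C_sub OE].
have O_sub u v : (u, v) \in O -> [/\ u != ord0, p u != ord0 & v = p u].
  rewrite OE inE => uv; have : (u, v) \in forest (tree p).
    by case/orP: uv => [/C_sub|]; rewrite inE => /andP[].
  by rewrite forest_tree // !inE => /andP[/andP[? ?] /eqP].
apply/setP => -[u v]; rewrite in_marks in_phi_S.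
apply/idP/and3P => [uv|[]].
  by have [u_neq0 pu vE] := O_sub _ _ uv; rewrite u_neq0 -vE uv eqxx vE.
by case/andP=> u_neq0 /orP[uv /eqP-> //|/eqP-> /eqP->]; rewrite eqxx.
Qed.

Lemma phi_valueP p O b : 0 < n -> rooted p ->
  phi (tree p, O) b <-> b = phi_value (tree p, O).
Proof.
move=> n_gt0 p_rooted; rewrite /phi_value /= tree_parent; last exact: p_rooted.1.
rewrite /phi /= -[in X in phi_loop _ _ X](@cut_id _ p set0); last first.
  by move=> x; rewrite inE.
rewrite -{2}[phi_S _ _]set0U -[map _ _]cat0s.
have S_cl := phi_S_root_closed p O; apply: phi_loopP => //.
- exact: card_phi_S.
- by split=> [|x _]; rewrite !inE ?eqxx.
- by apply/subsetP => u /(root_closed_neq0 S_cl); rewrite !inE.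
by rewrite disjoints_subset sub0set.
Qed.

Lemma psi_value_phi_value p O : 0 < n -> rooted p -> operational G (tree p) O ->
  psi_value (phi_value (tree p, O)) = (tree p, O).
Proof.
move=> n_gt0 p_rooted O_op; rewrite /psi_value /phi_value /= tree_parent;
  last exact: p_rooted.1.
rewrite roots_cut_phi_S psi_run_peel //; first by rewrite set0U -operational_marks.
- exact: phi_S_root_closed.
exact: card_phi_S.
Qed.

(** The arcs of the cut tree that do not end at [0] leave from outside [phi_S], so
    they are outside the operational set and hence in the complement of [G]. *)
Lemma phi_value_inB p O : 0 < n -> symmetric (compl G) -> rooted p ->
  operational G (tree p) O -> inB G (phi_value (tree p, O)).
Proof.
move=> n_gt0 G_sym p_rooted [C _ OE]; rewrite /phi_value /= tree_parent;
  last exact: p_rooted.1.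
have c_rooted := cut_rooted (phi_S (tree p) O) p_rooted.
split; last first.
  rewrite /weight_sequence /= components_tree //.
  by rewrite roots_cut_phi_S size_map size_peel subn1.
apply: tree_spanning => // u u_neq0; rewrite ffunE.
case: ifPn => [_|uS pu]; first by rewrite eqxx.
apply: contraR uS => uNG; rewrite in_phi_S u_neq0 /=; apply/orP; left.
by rewrite OE inE [X in _ || X]inE /valid_pairs forest_tree // !inE u_neq0 pu eqxx
  uNG orbT.
Qed.

(** Every pair in [B] is recorded by a tree [p], whose operational set consists of the
    arcs that [psi] adds away from [0]. *)
Lemma psi_valueP q W : 0 < n -> rooted q ->
    (forall u, u != ord0 -> q u != ord0 -> compl G u (q u)) ->
    weight_sequence (tree q) W ->
  [/\ inA G (psi_value (tree q, W)),
     forall a, psi (tree q, W) a <-> a = psi_value (tree q, W)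
    & phi_value (psi_value (tree q, W)) = (tree q, W)].
Proof.
move=> n_gt0 q_rooted qG; rewrite /weight_sequence components_tree //.
set R := roots (tree q) => sizeW.
have inR r : (r \in R) = (r != ord0) && (q r == ord0) by rewrite /R roots_tree inE.
have R_n0 : ord0 \notin R by rewrite inR eqxx.
have qR r : r \in R -> q r = ord0 by rewrite inR => /andP[_ /eqP].
have cardR : #|R| = (size W).+1.
  rewrite sizeW subn1 prednK //; apply/card_gt0P.
  have [//|r [r_neq0 qr _]] := @rooted_root _ q ord_max q_rooted.
    by rewrite -val_eqE /= -lt0n.
  by exists r; rewrite inR r_neq0 qr eqxx.
have W_R w r : w \in W -> r != ord0 -> q r = ord0 -> fconnect q w r -> r \in R.
  by move=> _ r_neq0 qr _; rewrite inR r_neq0 qr eqxx.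
have [loop_psi [p [p_rooted p_cl p_cut WE]]] :=
  psi_unpeel set0 q_rooted R_n0 qR cardR W_R.
have psiE : psi_value (tree q, W) = (tree p, marks p R).
  by rewrite /psi_value /= -/R -p_cut WE psi_run_peel ?set0U.
have qE u : u \notin R -> q u = p u by move=> uR; rewrite -p_cut ffunE (negPf uR).
have phi_SE : phi_S (tree p) (marks p R) = R.
  apply/setP => u; rewrite in_phi_S in_marks eqxx /=.
  have [uR|uR] := boolP (u \in R); first by rewrite (root_closed_neq0 p_cl uR) orNb.
  rewrite /= -qE //; apply/negP => /andP[u_neq0 qu]; by rewrite inR u_neq0 qu in uR.
split; rewrite ?psiE.
- split=> /=.
    apply: tree_spanning => // [x y|u u_neq0 pu].
      by rewrite /complete /= andbCA [x == y]eq_sym.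
    rewrite /complete /= u_neq0 pu /=.
    by apply: contraFneq (rooted_irr p_rooted u_neq0) => {2}->; apply: connect0.
  have Z_sub : Zset G (tree p) \subset marks p R.
    apply/subsetP => -[u v]; rewrite inE /valid_pairs forest_tree // [X in X && _]inE.
    rewrite inE /= in_marks.
    move=> /andP[/andP[/andP[u_neq0 pu] /eqP->] uNG]; rewrite eqxx pu !andbT.
    by apply: contraR uNG => uR; rewrite -qE // qG // qE.
  exists (marks p R :\: Zset G (tree p)).
    apply/setSD/subsetP => -[u v]; rewrite /valid_pairs forest_tree // in_marks.
    by case/and3P=> uR /eqP-> pu; rewrite !inE /= eqxx pu (root_closed_neq0 p_cl uR).
  apply/setP => a; rewrite in_setU in_setD.
  by case: (boolP (a \in Zset _ _)) => [/(subsetP Z_sub)->|_]; rewrite ?orbT ?orbF.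
- move=> a; split=> [/psi_loop_run -> | ->]; first exact: psiE.
  by rewrite -psiE.
rewrite /phi_value /= tree_parent; last exact: p_rooted.1.
by rewrite phi_SE cardR /= -WE p_cut.
Qed.

End Values.

Theorem theorem4p5 (n : nat) (n_gt0 : 0 < n) (G : rel 'I_n.+1)
    (G_graph : simple_graph G) :
  exists (f : arcs n * arcs n -> arcs n * seq 'I_n.+1)
         (g : arcs n * seq 'I_n.+1 -> arcs n * arcs n),
    [/\ forall a, inA G a -> inB G (f a) /\ (forall b, phi a b <-> b = f a),
        forall b, inB G b -> inA G (g b) /\ (forall a, psi b a <-> a = g b),
        forall a, inA G a -> g (f a) = a
      & forall b, inB G b -> f (g b) = b].
Proof.
have compl_sym : symmetric (compl G).
  case: G_graph => G_sym _ _ x y; rewrite /compl /= G_sym [y == x]eq_sym.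
  exact: andbCA.
have A_parent a : inA G a -> exists2 p, rooted p & a.1 = tree p.
  by case=> /spanning_tree_parent[x y /and3P[-> ->//]|p [Tp p_rooted _] _]; exists p.
have B_parent b : inB G b -> exists q,
    [/\ rooted q, b.1 = tree q & forall u, u != ord0 -> q u != ord0 -> compl G u (q u)].
  by case=> /spanning_tree_parent[x y /and4P[-> ->//]|q [Fq q_rooted qG] _]; exists q.
exists (@phi_value n), (@psi_value n); split.
- move=> [T O] inA_TO; have [p p_rooted /= Tp] := A_parent _ inA_TO.
  case: inA_TO => /= _; rewrite Tp => O_op; split; first exact: phi_value_inB.
  by move=> b; apply: phi_valueP.
- move=> [F W] inB_FW; have [q [q_rooted /= Fq qG]] := B_parent _ inB_FW.
  case: inB_FW => /= _; rewrite Fq => W_F.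
  by have [] := psi_valueP n_gt0 q_rooted qG W_F.
- move=> [T O] inA_TO; have [p p_rooted /= Tp] := A_parent _ inA_TO.
  case: inA_TO => /= _; rewrite Tp => O_op; exact: (@psi_value_phi_value _ G).
move=> [F W] inB_FW; have [q [q_rooted /= Fq qG]] := B_parent _ inB_FW.
case: inB_FW => /= _; rewrite Fq => W_F.
by have [] := psi_valueP n_gt0 q_rooted qG W_F.
Qed.
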